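(* Let $L$ be a semi-simple finite-dimensional Lie algebra over a field of characteristic $0$ and let $L=L_1\oplus\dots\oplus L_k$ be its decomposition into simple components (simple ideals). Then any Lie-orthogonal operator $J$ on $L$ can be represented in the form \[ J=J_1\oplus\dots\oplus J_k, \] where for each $i=1,\dots,k$ the operator $J_i$ on $L_i$ is either $J_i=\mathrm{Id}_{L_i}$ or $J_i=-\mathrm{Id}_{L_i}$.
   Context: A linear operator $J$ on a Lie algebra $L$ is called Lie-orthogonal if $[Jx,Jy]=[x,y]$ for all $x,y\in L$. For a direct sum $L=L_1\oplus\dots\oplus L_k$ of ideals and linear operators $J_i$ on $L_i$, $J_1\oplus\dots\oplus J_k$ denotes the operator on $L$ acting on each $L_i$ as $J_i$. *)

(* Defs.v *)
From HB Require Import structures.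
From mathcomp Require Import all_boot all_order all_algebra.

Set Implicit Arguments.
Unset Strict Implicit.
Unset Printing Implicit Defensive.

Import GRing.Theory.
Local Open Scope ring_scope.

Reserved Notation "[ 'lie' x , y ]"
  (at level 0, x, y at level 99, format "[ 'lie'  x ,  y ]").

(* Finite-dimensional Lie algebras: the dimension condition is part of Vector. *)
HB.mixin Record Vector_isLieAlgebra (K : fieldType) L of Vector K L := {
  lie : L -> L -> L;
  lie_linearl : forall y, linear (lie^~ y);
  lie_linearr : forall x, linear (lie x);
  liexx : forall x, lie x x = 0;
  lie_jacobi : forall x y z,
    lie x (lie y z) + lie y (lie z x) + lie z (lie x y) = 0
}.

#[short(type="lieAlgType")]
HB.structure Definition LieAlgebra (K : fieldType) :=
  { L of Vector_isLieAlgebra K L & Vector K L }.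

Notation "[ 'lie' x , y ]" := (lie x y) : ring_scope.

Section LieTheory.
Variables (K : fieldType) (L : lieAlgType K).
Implicit Types (U V W I : {vspace L}).

Definition lie_prodv U V : {vspace L} :=
  <<[seq [lie u, v] | u <- vbasis U, v <- vbasis V]>>%VS.

HB.instance Definition _ (x : L) :=
  GRing.isLinear.Build K L L *:%R (lie x) (lie_linearr x).

Lemma lie_prodvP U V W :
  reflect (forall u v, u \in U -> v \in V -> [lie u, v] \in W)
          (lie_prodv U V <= W)%VS.
Proof.
apply: (iffP span_subvP) => [sUVW u v uU vV | sUVW w].
  have linl y : linear (lie^~ y : L -> L) by apply: lie_linearl.
  rewrite (coord_vbasis uU) (coord_vbasis vV).
  set y := (X in [lie _, X]); rewrite {uU}.
  pose fM := GRing.isLinear.Build K L L *:%R (lie^~ y) (linl y).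
  pose f : {linear L -> L} := HB.pack (lie^~ y : L -> L) fM.
  rewrite -[[lie _, y]]/(f _) linear_sum; apply: memv_suml => i _.
  rewrite linearZ; apply: memvZ; rewrite /f /= /y linear_sum.
  apply: memv_suml => j _; rewrite linearZ; apply: memvZ.
  by apply: sUVW; apply: allpairs_f; rewrite mem_nth ?size_tuple.
case/allpairsP=> -[u v] /= [uU vV ->].
by apply: sUVW; apply: vbasis_mem.
Qed.

(* I is an ideal of the subalgebra U. *)
Definition lie_ideal U I : bool := (I <= U)%VS && (lie_prodv U I <= I)%VS.

Fixpoint lie_derived (n : nat) U : {vspace L} :=
  if n is n'.+1 then lie_prodv (lie_derived n' U) (lie_derived n' U) else U.

Definition lie_solvable U : Prop := exists n, lie_derived n U = 0%VS.

(* S, a subalgebra of L, is simple as a Lie algebra in its own right. *)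
Definition lie_simple (S : {vspace L}) : Prop :=
  lie_prodv S S != 0%VS /\
  forall I, lie_ideal S I -> I = 0%VS \/ I = S.

Definition lie_orthogonal (J : 'End(L)) : Prop :=
  forall x y : L, [lie J x, J y] = [lie x, y].

End LieTheory.

(* The radical, i.e. the largest solvable ideal, is zero. *)
Definition lie_semisimple (K : fieldType) (L : lieAlgType K) : Prop :=
  forall I : {vspace L}, lie_ideal fullv I -> lie_solvable I -> I = 0%VS.

Section DirectSumOfOperators.
Variables (K : fieldType) (L : vectType K) (k : nat) (Ls : 'I_k -> {vspace L}).

(* Only meaningful when L is the direct sum of the Ls i, in which case
   sumv_pi _ i is the projection on Ls i along the other summands. *)
Definition dsum_lfun (Js : forall i, 'End(subvs_of (Ls i))) : 'End(L) :=
  \sum_i (linfun vsval \o Js i \o linfun (vsproj (Ls i))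
            \o sumv_pi (\sum_i Ls i)%VS i)%VF.

Lemma dsum_lfunE Js i (x : subvs_of (Ls i)) :
  directv (\sum_i Ls i)%VS -> dsum_lfun Js (vsval x) = vsval (Js i x).
Proof.
move=> dxLs.
have xL : vsval x \in (\sum_i Ls i)%VS.
  by apply: (subvP (sumv_sup i _ _)) (subvsP x).
pose y j := if j == i then vsval x else 0.
have inL j : y j \in Ls j.
  by rewrite /y; case: eqP => [->|_]; [apply: subvsP | apply: mem0v].
have piE j : sumv_pi (\sum_i Ls i)%VS j (vsval x) = y j.
  suff /forallP/(_ j)/eqP : [forall j, sumv_pi (\sum_i Ls i)%VS j (vsval x) == y j].
    by [].
  rewrite -(directv_sum_unique dxLs) => [|l _|l _]; last exact: inL.
    by rewrite sumv_pi_sum // -big_mkcond big_pred1_eq.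
  exact: memv_sum_pi.
rewrite /dsum_lfun sum_lfunE.
transitivity (\sum_j vsval (Js j (vsproj (Ls j) (y j)))).
  by apply: eq_bigr => j _; rewrite !comp_lfunE piE !lfunE.
rewrite (bigD1 i) //= big1 ?addr0 /y ?eqxx ?vsvalK // => j /negPf ->.
by rewrite !linear0.
Qed.

End DirectSumOfOperators.

(* Main.v *)
(** Write kappa for the Killing form of L. If J is Lie-orthogonal, then J is
    invertible because L has no center, and B = J - J^-1 satisfies
    [B x, y] = - [x, B y]. The trilinear form kappa([B x, y], z) is then
    symmetric in (x, y) and antisymmetric in (y, z), hence zero; as kappa is
    nondegenerate, B = 0. So J^2 = 1 and [J x, y] = [x, J y], the eigenspaces of
    J for 1 and -1 are commuting ideals whose sum is L, and each simple ideal
    lies in one of them.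

    Nondegeneracy of kappa is Cartan's criterion. If P is a perfect ideal in the
    radical of kappa and x lies in P, let E_i be the spectral projections of ad x
    over a splitting field, a_i its eigenvalues and m_i their multiplicities. For
    a Q-linear functional c on the Q-span of the a_i, Y = \sum_i c(a_i) E_i is a
    derivation, whence 0 = tr(ad x Y) = \sum_i m_i c(a_i) a_i, and applying c
    gives \sum_i m_i c(a_i)^2 = 0. Thus all a_i vanish, ad x is nilpotent, and
    P = 0 by Engel's theorem. *)

From HB Require Import structures.
Require Import Defs.
From mathcomp Require Import all_boot all_order all_algebra.
From mathcomp Require Import fieldext.
From Stdlib Require Classical_Prop.

Set Implicit Arguments.
Unset Strict Implicit.
Unset Printing Implicit Defensive.

Import GRing.Theory Num.Theory passmx.
Local Open Scope ring_scope.

(** * Linear algebra: subspaces, splitting fields, traces *)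

(** A subspace of maximal dimension among those inside [P] exhausts [P], since a missed vector would
    enlarge it. Its main use is to reduce a claim about all of a span, such as [lie_prodv U V], to
    the generating brackets. *)
Lemma vspace_of_pred (K : fieldType) (V : vectType K) (P : V -> Prop) :
  P 0 -> (forall a u v, P u -> P v -> P (a *: u + v)) ->
  exists W : {vspace V}, forall v, v \in W <-> P v.
Proof.
move=> P0 Plin; apply: Classical_Prop.NNPP => noW.
suff [W [_ /leq_trans/(_ (dimvS (subvf W)))]] : exists W : {vspace V},
    (forall v, v \in W -> P v) /\ ((\dim {: V}).+1 <= \dim W)%N.
  by rewrite ltnn.
elim: (\dim {: V}).+1 => [|d [W [WP dW]]].
  by exists 0%VS; split=> // v; rewrite memv0 => /eqP->.
have [x [Px xW]] : exists x, P x /\ x \notin W.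
  apply: Classical_Prop.NNPP => noX; apply: noW; exists W => v; split=> [/WP//|Pv].
  by apply: contraT => vW; case: noX; exists v.
exists (W + <[x]>)%VS; split.
  move=> _ /memv_addP[w wW [_ /vlineP[a ->] ->]].
  by rewrite addrC; apply: Plin => //; apply: WP.
apply: leq_ltn_trans dW _; rewrite ltnNge.
apply: contra xW => le_dim.
have /eqP-> : W == (W + <[x]>)%VS by rewrite eqEdim addvSl.
by rewrite memvE addvSr.
Qed.

(** Induction on the size of [p], over all base fields at once: adjoin a root of an irreducible
    factor and split the quotient over the larger field. *)
Lemma splitting_field_exists (F : fieldType) (p : {poly F}) : p != 0 ->
  exists (E : fieldType) (f : {rmorphism F -> E}) (zs : seq E),
    map_poly f p %= \prod_(z <- zs) ('X - z%:P).
Proof.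
move: {2}_.+1 (ltnSn (size p)) => n; elim: n => // n IHn in F p *.
rewrite ltnS => ltpn p0.
have [p1|p1] := leqP (size p) 1.
  exists F, idfun, [::]; rewrite map_poly_id // big_nil -size_poly_eq1.
  by rewrite eqn_leq p1 size_poly_gt0.
have [r r_dv_p irr_r] : exists2 r, r %| p & irreducible_poly r.
  suff: forall m (q : {poly F}), (size q < m)%N -> (1 < size q)%N -> q %| p ->
      exists2 r, r %| p & irreducible_poly r.
    by move/(_ (size p).+1 p); apply.
  elim=> // m IHm q; rewrite ltnS => ltqm q1 q_dv_p.
  have [|red_q] := Classical_Prop.classic (irreducible_poly q).
    by exists q.
  have [s [s1 s_dv_q nqs]] : exists s : {poly F}, [/\ size s != 1, s %| q & ~~ (s %= q)].
    apply: Classical_Prop.NNPP => noS; apply: red_q; split=> // s s1 s_dv_q.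
    by apply: contraT => nqs; case: noS; exists s.
  have q0 : q != 0 by rewrite -size_poly_gt0 ltnW.
  have s0 : s != 0 by apply: contraTneq s_dv_q => ->; rewrite dvd0p.
  apply: (IHm s); last exact: dvdp_trans q_dv_p.
    apply: leq_trans ltqm; rewrite ltn_neqAle dvdp_leq // andbT.
    by rewrite dvdp_size_eqp.
  by rewrite ltn_neqAle eq_sym s1 size_poly_gt0.
have [E0 _ [x rx0 _]] := irredp_FAdjoin irr_r.
have /factor_theorem[q Dp] : root (map_poly (in_alg E0) p) x.
  by rewrite -(divpK r_dv_p) rmorphM rootM rx0 orbT.
have q0 : q != 0.
  by apply: contraNneq p0 => q0; rewrite -(map_poly_eq0 (in_alg E0)) Dp q0 mul0r.
have [|E [g [zs Dq]]] := IHn E0 q _ q0.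
  move: ltpn; rewrite -(size_map_poly (in_alg E0)) Dp size_mul ?polyXsubC_eq0 //.
  by rewrite size_XsubC addn2.
exists E, (g \o in_alg E0 : {rmorphism F -> E}), (g x :: zs).
rewrite map_poly_comp Dp rmorphM big_cons mulrC /= rmorphB /= map_polyX map_polyC.
by rewrite eqp_mull.
Qed.

(** In the full-rank factorization A = C R, idempotence forces R C = 1, an identity matrix of size
    the rank of A, and tr (C R) = tr (R C). *)
Lemma mxtrace_idem (F : fieldType) n (A : 'M[F]_n) :
  A *m A = A -> \tr A = (\rank A)%:R.
Proof.
move=> AA; rewrite -{1}(mulmx_base A) mxtrace_mulC.
suff ->: row_base A *m col_base A = 1%:M by rewrite mxtrace1.
apply: (row_full_inj (col_base_full A)); apply: (row_free_inj (row_base_free A)).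
by rewrite /= mulmx1 mulmxA mulmx_base -mulmxA mulmx_base.
Qed.

(** With A = C R of full rank and B = R C, one has C B^k R = A^(k+1). So B has the same trace as A
    and a nilpotency exponent lower by one. *)
Lemma mxtrace_nilpotent (F : fieldType) n (A : 'M[F]_n) m : A ^+ m = 0 -> \tr A = 0.
Proof.
elim: m n A => [|m IHm] n A.
  by rewrite expr0 => A1; rewrite -[A]mul1r A1 mul0r mxtrace0.
move=> Am; rewrite -{1}(mulmx_base A) mxtrace_mulC.
set B := row_base A *m col_base A.
have BA k : col_base A *m (B ^+ k : 'M_(\rank A)) *m row_base A = A ^+ k.+1.
  elim: k => [|k IHk]; first by rewrite expr0 expr1 mulmx1 mulmx_base.
  rewrite exprSr [RHS]exprSr -IHk /GRing.mul /= -[RHS]mulmxA.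
  by rewrite -[X in _ = _ *m (_ *m X)](mulmx_base A) !mulmxA.
apply: IHm; apply: (row_full_inj (col_base_full A)).
apply: (row_free_inj (row_base_free A)).
by rewrite /= mulmx0 mul0mx BA.
Qed.

(** * The embedding of the rationals in a field of characteristic 0 *)

Section Ratr0.
Variables (F : fieldType) (F0 : [pchar F] =i pred0).

Lemma pchar0_intr_eq0 (z : int) : (z%:~R == 0 :> F) = (z == 0).
Proof.
have /pcharf0P nat0 := F0.
by case: z => z; rewrite ?NegzE ?mulrNz ?oppr_eq0 -pmulrn nat0.
Qed.

(** The value of [ratr q] may be computed from any fraction representing [q], not only the reduced
    one; sums and products are then compared over a common denominator. *)
Lemma pchar0_ratr_frac (q : rat) (a b : int) : b != 0 ->
  q * b%:~R = a%:~R -> ratr q * b%:~R = a%:~R :> F.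
Proof.
move=> b0 qb; have d0 : (denq q)%:~R != 0 :> F by rewrite pchar0_intr_eq0 denq_eq0.
rewrite /ratr mulrAC; apply: (canLR (mulfK d0)); rewrite -!intrM; congr _%:~R.
by apply: (@intr_inj rat); rewrite !intrM -qb numqE mulrAC.
Qed.

Lemma pchar0_ratr_zmod_morphism : zmod_morphism (@ratr F).
Proof.
move=> x y; pose b := (denq x * denq y)%Z.
have b0 : b != 0 by rewrite mulf_neq0 ?denq_eq0.
have bF : b%:~R != 0 :> F by rewrite pchar0_intr_eq0.
apply: (mulIf bF); rewrite mulrBl.
rewrite (@pchar0_ratr_frac x (numq x * denq y)%Z) //; last first.
  by rewrite /b !intrM numqE mulrA.
rewrite (@pchar0_ratr_frac y (numq y * denq x)%Z) //; last first.
  by rewrite /b !intrM numqE -mulrA; congr (_ * _); rewrite mulrC.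
rewrite -intrB; apply: pchar0_ratr_frac => //.
rewrite /b mulrBl intrB !intrM !numqE mulrA; congr (_ - _).
by rewrite -mulrA; congr (_ * _); rewrite mulrC.
Qed.

Lemma pchar0_ratr_monoid_morphism : monoid_morphism (@ratr F).
Proof.
split=> [|x y]; first exact: (ratr_nat F 1).
pose b := (denq x * denq y)%Z.
have b0 : b != 0 by rewrite mulf_neq0 ?denq_eq0.
have bF : b%:~R != 0 :> F by rewrite pchar0_intr_eq0.
apply: (mulIf bF); rewrite [in RHS]intrM [RHS]mulrACA.
rewrite (@pchar0_ratr_frac x (numq x)) ?denq_eq0 ?numqE //.
rewrite (@pchar0_ratr_frac y (numq y)) ?denq_eq0 ?numqE //.
rewrite -[RHS]intrM; apply: pchar0_ratr_frac => //.
by rewrite /b !intrM !numqE mulrACA.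
Qed.

Definition pchar0_ratr : {rmorphism rat -> F} :=
  HB.pack (@ratr F)
    (GRing.isZmodMorphism.Build rat F (@ratr F) pchar0_ratr_zmod_morphism)
    (GRing.isMonoidMorphism.Build rat F (@ratr F) pchar0_ratr_monoid_morphism).

End Ratr0.

(** * Coprime factors and spectral idempotents *)

Lemma coprimep_prodr (F : fieldType) (I : Type) (s : seq I) (P : pred I)
    (p : {poly F}) (q : I -> {poly F}) :
  coprimep p (\prod_(i <- s | P i) q i) = all (fun i => P i ==> coprimep p (q i)) s.
Proof.
rewrite (@big_morph _ _ _ true andb) ?big_all_cond ?coprimep1 // => u v.
by rewrite coprimepMr.
Qed.

Lemma dvdp_prod_coprime (F : fieldType) (I : eqType) (s : seq I)
    (p : I -> {poly F}) (q : {poly F}) :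
    uniq s -> (forall i j, j != i -> coprimep (p i) (p j)) ->
  (forall i, p i %| q) -> \prod_(i <- s) p i %| q.
Proof.
move=> + cop dvq; elim: s => [|i s IHs] /=; first by rewrite big_nil dvd1p.
move=> /andP[is_ us]; rewrite big_cons Gauss_dvdp ?dvq ?IHs //.
rewrite coprimep_prodr; apply/allP => j js; apply/implyP => _; apply: cop.
by apply: contraNneq is_ => <-.
Qed.

(** Chinese remaindering: with p_i the i-th factor, q_i the product of the others and u_i an inverse
    of q_i modulo p_i, the polynomial u_i q_i is 1 modulo p_i and 0 modulo every other p_j.
    Evaluating it at [D] gives [E i]. *)
Lemma spectral_idempotents (F : fieldType) n (D : 'M[F]_n.+1) r (a : 'I_r -> F) N :
    injective a -> horner_mx D (\prod_i ('X - (a i)%:P) ^+ N) = 0 ->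
  exists E : 'I_r -> 'M[F]_n.+1,
    [/\ \sum_i E i = 1, forall i j, i != j -> E i * E j = 0,
        forall i, E i * (D - (a i)%:M) ^+ N = 0 & forall i, GRing.comm (E i) D].
Proof.
move=> inj_a PD0; pose p i := ('X - (a i)%:P) ^+ N.
have cop i j : j != i -> coprimep (p i) (p j).
  move=> ji; rewrite coprimep_expl ?coprimep_expr // coprimep_XsubC root_XsubC.
  by rewrite (inj_eq inj_a).
pose q i := \prod_(j | j != i) p j.
have pqE i : \prod_j p j = p i * q i by rewrite (bigD1 i).
have dvq i j : i != j -> p i %| q j by move=> ij; rewrite /q (bigD1 i) ?dvdp_mulr.
have [u uP] : exists u : 'I_r -> {poly F}, forall i, p i %| u i * q i - 1.
  apply: (@fin_all_exists _ _ (fun i v => p i %| v * q i - 1)) => i.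
  have /Bezout_eq1_coprimepP[[v w] /= vw1] : coprimep (p i) (q i).
    by rewrite coprimep_prodr; apply/allP => j _; apply/implyP; apply: cop.
  by exists w; rewrite -vw1 opprD addrCA subrr addr0 dvdpNr dvdp_mull.
have hm0 s : \prod_j p j %| s -> horner_mx D s = 0.
  by case/dvdpP=> t ->; rewrite rmorphM /= PD0 mulr0.
exists (fun i => horner_mx D (u i * q i)); split=> [|i j ij|i|i].
- apply/eqP; rewrite -subr_eq0 -(rmorph_sum (horner_mx D)) -(rmorph1 (horner_mx D)).
  rewrite -rmorphB /= hm0 //; apply: dvdp_prod_coprime => // [|i].
    exact: index_enum_uniq.
  rewrite (bigD1 i) //= addrAC dvdp_add //; apply: (big_ind (fun s => p i %| s)).
  + exact: dvdp0.
  + by move=> s t; apply: dvdp_add.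
  + by move=> j ji; rewrite dvdp_mull // dvq // eq_sym.
- rewrite -rmorphM /= hm0 // (pqE i) mulrACA dvdp_mull // mulrC.
  by rewrite dvdp_mul // dvq.
- have -> : (D - (a i)%:M) ^+ N = horner_mx D (p i).
    by rewrite rmorphXn rmorphB /= horner_mx_X horner_mx_C.
  by rewrite -rmorphM /= hm0 // (pqE i) -mulrA dvdp_mull // mulrC.
- by apply/comm_mx_sym/comm_mx_horner.
Qed.

(** * Replicas of a derivation *)

Lemma sumr_pred1 (R : pzRingType) r (f : 'I_r -> R) i :
  \sum_x (x == i)%:R * f x = f i.
Proof.
rewrite (bigD1 i) //= eqxx mul1r big1 ?addr0 // => x /negPf->.
by rewrite mul0r.
Qed.

(* [D] is a derivation of the bilinear product [(b, v) |-> v *m ad b]. *)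
Definition mx_derivation (F : fieldType) n (ad : 'rV[F]_n -> 'M[F]_n) (D : 'M[F]_n) :=
  forall b, ad (b *m D) = ad b *m D - D *m ad b.

Section Replica.
Variables (F : fieldType) (F0 : [pchar F] =i pred0).

(** Generalized eigenspaces multiply with eigenvalues added. Writing [b, v] for [v *m ad b], one has
    [b, v] (D - a - c) = [b (D - a), v] + [b, v (D - c)], and each term lowers [p] or [q]. *)
Lemma mx_derivation_shift n (ad : {linear 'rV[F]_n -> 'M[F]_n}) (D : 'M[F]_n)
    (a c : F) p q (b v : 'rV[F]_n) : mx_derivation ad D ->
    b *m (D - a%:M) ^+ p = 0 -> v *m (D - c%:M) ^+ q = 0 ->
  v *m ad b *m (D - (a + c)%:M) ^+ (p + q) = 0.
Proof.
move=> derD; move: {2}(p + q)%N (leqnn (p + q)) => m.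
elim: m p q b v => [|m IHm] p q b v.
  rewrite leqn0 addn_eq0 => /andP[/eqP-> _].
  by rewrite expr0 mulmx1 => -> _; rewrite linear0 mulmx0 mul0mx.
case: p => [_|p].
  by rewrite expr0 mulmx1 => -> _; rewrite linear0 mulmx0 mul0mx.
case: q => [_|q].
  by rewrite [_ ^+ 0]expr0 mulmx1 => _ ->; rewrite !mul0mx.
rewrite addSn ltnS => le_pqm bp vq.
have step : v *m ad b *m (D - (a + c)%:M) =
    v *m ad (b *m (D - a%:M)) + v *m (D - c%:M) *m ad b.
  rewrite mulmxBr mul_mx_scalar [b *m _]mulmxBr mul_mx_scalar.
  rewrite linearB [ad (a *: b)]linearZ derD /= [v *m (D - _)]mulmxBr mul_mx_scalar.
  rewrite mulmxBl -scalemxAl !mulmxBr.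
  rewrite -scalemxAr !mulmxA scalerDl opprD !addrA; congr (_ - _).
  by rewrite [RHS]addrAC subrK.
have expS M k (w : 'rV[F]_n) : w *m M ^+ k.+1 = w *m M *m M ^+ k.
  by rewrite exprS /GRing.mul /= mulmxA.
rewrite expS step mulmxDl.
rewrite IHm ?add0r //; last by rewrite -expS.
by rewrite addnS -addSn in le_pqm *; rewrite IHm // -expS.
Qed.

Lemma replica_nilpotent n (ad : {linear 'rV[F]_n -> 'M[F]_n}) (D : 'M[F]_n) (zs : seq F) :
    mx_derivation ad D -> char_poly D %= \prod_(z <- zs) ('X - z%:P) ->
    (forall Y, mx_derivation ad Y -> \tr (D *m Y) = 0) ->
  exists m, D ^+ m = 0.
Proof.
case: n ad D => [|n] ad D derD Dzs trDY; first by exists 1; rewrite [_ ^+ 1]flatmx0.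
pose s := undup zs; pose N := size zs.
pose a (i : 'I_(size s)) := s`_i.
have inj_a : injective a.
  by move=> i j /eqP; rewrite nth_uniq ?undup_uniq // => /eqP/val_inj.
(* [N] bounds the multiplicity of every root in [zs], so the product is a multiple of the
   characteristic polynomial, and Cayley-Hamilton applies. *)
have PD0 : horner_mx D (\prod_i ('X - (a i)%:P) ^+ N) = 0.
  have /dvdpP[u ->] : char_poly D %| \prod_i ('X - (a i)%:P) ^+ N.
    rewrite (eqp_dvdl _ Dzs) -(big_mkord xpredT (fun i => ('X - (s`_i)%:P) ^+ N)).
    rewrite -(big_nth 0 xpredT (fun z => ('X - z%:P) ^+ N)).
    rewrite -prodr_undup_exp_count.
    apply: (big_ind2 (fun u v : {poly F} => u %| v)) => [|u1 v1 u2 v2|z _] //.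
      exact: dvdp_mul.
    by rewrite dvdp_exp2l // count_size.
  by rewrite rmorphM /= Cayley_Hamilton mulr0.
have [E [sumE ortE nilE comE]] := spectral_idempotents inj_a PD0.
have idE i : E i * E i = E i.
  rewrite -[RHS]mulr1 -sumE mulr_sumr (bigD1 i) //= big1 ?addr0 // => j ji.
  by rewrite ortE // eq_sym.
have trE i : \tr (D *m E i) = a i * (\rank (E i))%:R.
  rewrite -mxtrace_idem; last exact: idE.
  have -> : D *m E i = a i *: E i + E i * (D - (a i)%:M).
    rewrite mulrBr -[E i * (a i)%:M]/(E i *m _) mul_mx_scalar.
    by rewrite [RHS]addrC subrK comE.
  (* The exponent [N.+1] instead of [N] leaves a factor [E i] next to the [N]-th power that it
     annihilates. *)
  rewrite mxtraceD mxtraceZ (@mxtrace_nilpotent _ _ (E i * _) N.+1) ?addr0 //.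
  have comEa : GRing.comm (E i) (D - (a i)%:M).
    by apply: commrB; [apply: comE | apply: comm_mx_scalar].
  by rewrite exprMn_comm // !exprSr mulrA -[_ * E i * _]mulrA nilE mulr0 mul0r.
(* If only the eigenvalue 0 carries a nonzero projection, then every [E i * D ^+ N] vanishes, and
   these sum to [D ^+ N]. *)
suff aE k : E k = 0 \/ a k = 0.
  exists N; rewrite -[LHS]mul1r -sumE mulr_suml big1 // => i _.
  have [->|ai0] := aE i; first by rewrite mul0r.
  by rewrite -[RHS](nilE i) ai0 raddf0 subr0.
have [->|/eqP Ek] := Classical_Prop.classic (E k = 0); first by left.
right; apply/eqP; apply: contraT => ak.
pose rho := pchar0_ratr F0.
(* [W] is the space of rational relations among the [a i], so the quotient by [W] is their Q-span.
   The map [phi] below has kernel [W], and a coordinate of it is a Q-linear functional on that span;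
   [j] is chosen so that it does not vanish at [a k]. *)
have [||W WP] := @vspace_of_pred rat 'rV[rat]_(size s)
    (fun q => \sum_i rho (q 0 i) * a i = 0).
- by rewrite big1 // => i _; rewrite mxE rmorph0 mul0r.
- move=> t u v u0 v0.
  under eq_bigr do rewrite !mxE rmorphD rmorphM mulrDl -mulrA.
  by rewrite big_split /= -mulr_sumr u0 v0 mulr0 addr0.
pose phi q : 'rV[rat]_(size s) := q - projv W q.
have [j phik] : exists j, phi (delta_mx 0 k) 0 j != 0.
  apply: Classical_Prop.NNPP => nox; case/negP: ak; apply/eqP.
  have : delta_mx 0 k \in W.
    suff -> : delta_mx 0 k = projv W (delta_mx 0 k) by rewrite memv_proj.
    apply/eqP; rewrite -subr_eq0; apply/eqP/rowP => j; rewrite [RHS]mxE.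
    by apply/eqP; apply: contraT => nz; case: nox; exists j.
  move/WP; rewrite (bigD1 k) //= mxE !eqxx /= [rho _]rmorph1 mul1r big1 ?addr0 // => l lk.
  by rewrite mxE eqxx (negPf lk) /= [rho _]rmorph0 mul0r.
pose c i := phi (delta_mx 0 i) 0 j.
have cW (q : 'rV[rat]_(size s)) : \sum_i rho (q 0 i) * a i = 0 -> \sum_i q 0 i * c i = 0.
  move=> q0; have qW : q \in W by apply/WP.
  have : phi q 0 j = 0 by rewrite /phi projv_id // subrr mxE.
  rewrite [in X in X -> _](row_sum_delta q) /phi linear_sum -sumrB summxE => q1.
  rewrite -[RHS]q1.
  by apply: eq_bigr => i _; rewrite linearZ -scalerBr [RHS]mxE.
pose Y := \sum_i rho (c i) *: E i.
have EY i : E i *m Y = rho (c i) *: E i.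
  rewrite mulmx_sumr (bigD1 i) //= -scalemxAr [_ *m _]idE big1 ?addr0 // => l li.
  by rewrite -scalemxAr [_ *m _]ortE ?scaler0 // eq_sym.
have YE i : Y *m E i = rho (c i) *: E i.
  rewrite mulmx_suml (bigD1 i) //= -scalemxAl [_ *m _]idE big1 ?addr0 // => l li.
  by rewrite -scalemxAl [_ *m _]ortE ?scaler0.
(* [Y] scales the generalized eigenspace of [mu] by [d]. If [mu] is none of the [a i], that space is
   zero and the condition on [d] is vacuous. *)
have eigY (w : 'rV[F]_n.+1) mu d m : w *m (D - mu%:M) ^+ m = 0 ->
    (forall i, a i = mu -> c i = d) -> w *m Y = rho d *: w.
  move=> w0 cd; rewrite -[w in RHS]mulmx1 -[1%:M]sumE !mulmx_sumr scaler_sumr.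
  apply: eq_bigr => i _; rewrite -scalemxAr.
  have [/cd->//|/eqP ai] := Classical_Prop.classic (a i = mu).
  suff -> : w *m E i = 0 by rewrite !scaler0.
  have : coprimep (('X - (a i)%:P) ^+ N) (('X - mu%:P) ^+ m).
    by rewrite coprimep_expl ?coprimep_expr // coprimep_XsubC root_XsubC eq_sym.
  case/Bezout_eq1_coprimepP=> -[u v] /(congr1 (fun p => w *m E i *m horner_mx D p)).
  have hX x q : horner_mx D (('X - x%:P) ^+ q) = (D - x%:M) ^+ q.
    by rewrite rmorphXn rmorphB /= horner_mx_X horner_mx_C.
  have comED q x : E i *m (D - x%:M) ^+ q = (D - x%:M) ^+ q *m E i.
    by apply: commrX; apply: commrB; [apply: comE | apply: comm_mx_scalar].
  rewrite /= rmorph1 mulmx1 mulrC [v * _]mulrC rmorphD !rmorphM /= !hX => <-.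
  rewrite mulmxDr !mulmxA -[w *m E i *m _]mulmxA [E i *m _]nilE mulmx0 mul0mx add0r.
  by rewrite -[w *m E i *m _]mulmxA comED mulmxA w0 !mul0mx.
have derY : mx_derivation ad Y.
  clearbody Y.
  have sumM (M : 'M_n.+1) : M = \sum_l E l *m M.
    by rewrite -mulmx_suml [\sum_l _]sumE mul1mx.
  have ad_sum b : ad b = \sum_i ad (b *m E i).
    by rewrite -linear_sum -mulmx_sumr [\sum_l _]sumE mulmx1.
  move=> b; rewrite (ad_sum (b *m Y)) (ad_sum b) mulmx_suml mulmx_sumr -sumrB.
  apply: eq_bigr => i _; rewrite -mulmxA YE -scalemxAr linearZ /=.
  rewrite [LHS]sumM [RHS]sumM; apply: eq_bigr => l _; apply/row_matrixP => t.
  rewrite !row_mul; set v := row t (E l); rewrite mulmxBr !mulmxA.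
  have vY : v *m Y = rho (c l) *: v by rewrite -row_mul EY linearZ.
  have v0 : v *m (D - (a l)%:M) ^+ N = 0 by rewrite -row_mul [_ *m _]nilE row0.
  have b0 : b *m E i *m (D - (a i)%:M) ^+ N = 0.
    by rewrite -mulmxA [E i *m _]nilE mulmx0.
  rewrite (eigY _ _ (c i + c l) _ (mx_derivation_shift derD b0 v0)) => [|u au].
    by rewrite vY -scalemxAl -scalerBl -rmorphB addrK scalemxAr.
  (* Here [a u = a i + a l], a rational relation, so [c] is additive on it. *)
  have := cW (\row_x ((x == i)%:R + (x == l)%:R - (x == u)%:R)).
  under eq_bigr do rewrite mxE rmorphB rmorphD !rmorph_nat mulrBl mulrDl.
  rewrite sumrB big_split /= !sumr_pred1 au subrr => /(_ erefl).
  under eq_bigr do rewrite mxE mulrBl mulrDl.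
  by rewrite sumrB big_split /= !sumr_pred1 => /eqP; rewrite subr_eq0 => /eqP.
(* The vanishing of tr (D Y) is itself a rational relation among the [a i], with coefficients
   [c i * rank (E i)]. Applying [cW] gives a vanishing sum of nonnegative rationals. *)
have := cW (\row_i (c i * (\rank (E i))%:R)).
have trDY0 := trDY _ derY.
have -> : \sum_i rho ((\row_i (c i * (\rank (E i))%:R)) 0 i) * a i = 0.
  rewrite -[RHS]trDY0 /Y mulmx_sumr raddf_sum; apply: eq_bigr => i _ /=.
  rewrite mxE -scalemxAr mxtraceZ trE [rho _]rmorphM.
  by rewrite [rho _%:R]rmorph_nat -mulrA [_%:R * _]mulrC.
move=> /(_ erefl); under eq_bigr do rewrite mxE mulrAC.
move/psumr_eq0P => ck0.
suff /ck0/(_ k isT)/eqP : forall i, true -> 0 <= c i * c i * (\rank (E i))%:R.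
  by rewrite !mulf_eq0 orbb pnatr_eq0 mxrank_eq0 (negPf Ek) orbF (negPf phik).
by move=> i _; rewrite mulr_ge0 ?ler0n // -expr2 sqr_ge0.
Qed.

End Replica.

(** * Bracket identities, ideals and the derived series *)

Section LieIdentities.
Variables (K : fieldType) (L : lieAlgType K).
Implicit Types (x y z : L) (U V W P : {vspace L}).

Lemma lieDl x y z : [lie x + y, z] = [lie x, z] + [lie y, z].
Proof. by have := lie_linearl z 1 x y; rewrite !scale1r. Qed.

Lemma lie0l y : [lie 0, y] = 0 :> L.
Proof. by apply: (addrI [lie 0, y]); rewrite -lieDl !addr0. Qed.

Lemma lieZl a x y : [lie a *: x, y] = a *: [lie x, y].
Proof. by have := lie_linearl y a x 0; rewrite !addr0 lie0l addr0. Qed.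

Lemma lieNl x y : [lie - x, y] = - [lie x, y].
Proof. by rewrite -scaleN1r lieZl scaleN1r. Qed.

Lemma lieBl x y z : [lie x - y, z] = [lie x, z] - [lie y, z].
Proof. by rewrite lieDl lieNl. Qed.

Lemma lieC x y : [lie x, y] = - [lie y, x].
Proof.
apply/eqP; rewrite -addr_eq0; have := liexx (x + y).
by rewrite lieDl !linearD /= !liexx add0r addr0 => ->.
Qed.

Lemma lie_leibniz x y z : [lie x, [lie y, z]] = [lie [lie x, y], z] + [lie y, [lie x, z]].
Proof.
have /eqP := lie_jacobi x y z; rewrite -addrA addr_eq0 => /eqP->.
by rewrite opprD addrC (lieC z) opprK -linearN /= -lieC.
Qed.

Lemma lie_idealP P :
  reflect (forall x y, y \in P -> [lie x, y] \in P) (lie_ideal fullv P).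
Proof.
rewrite /lie_ideal subvf; apply: (iffP (lie_prodvP _ _ _)) => P_ideal x y.
  exact: P_ideal (memvf x).
by move=> _; apply: P_ideal.
Qed.

Lemma lie_prodv_mem U V x y : x \in U -> y \in V -> [lie x, y] \in lie_prodv U V.
Proof. by move: x y; apply/lie_prodvP. Qed.

Lemma lie_prodvS U1 U2 V1 V2 :
  (U1 <= U2)%VS -> (V1 <= V2)%VS -> (lie_prodv U1 V1 <= lie_prodv U2 V2)%VS.
Proof.
move=> sU sV; apply/lie_prodvP => x y /(subvP sU) xU /(subvP sV).
exact: lie_prodv_mem.
Qed.

Lemma lie_prodv_ideal U V :
  lie_ideal fullv U -> lie_ideal fullv V -> lie_ideal fullv (lie_prodv U V).
Proof.
move=> /lie_idealP idU /lie_idealP idV; apply/lie_idealP => x.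
have [||W WP] := @vspace_of_pred _ _ (fun y => [lie x, y] \in lie_prodv U V).
- by rewrite linear0 mem0v.
- by move=> a u v u0 v0; rewrite linearP memvD ?memvZ.
move=> y yUV; apply/WP; apply: subvP yUV; apply/lie_prodvP => u v uU vV.
by apply/WP; rewrite lie_leibniz memvD ?lie_prodv_mem ?idU ?idV.
Qed.

Lemma lie_derived_ideal n U : lie_ideal fullv U -> lie_ideal fullv (lie_derived n U).
Proof. by move=> idU; elim: n => //= n IHn; apply: lie_prodv_ideal. Qed.

(** Otherwise the dimension would drop at every step of the series, more than \dim U times. *)
Lemma lie_derived_stable U : lie_ideal fullv U ->
  exists n, lie_prodv (lie_derived n U) (lie_derived n U) = lie_derived n U.
Proof.
move=> idU; apply: Classical_Prop.NNPP => noP.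
suff: forall n, (\dim (lie_derived n U) + n <= \dim U)%N.
  by move/(_ (\dim U).+1); rewrite addnS ltnNge leq_addl.
elim=> [|n IHn]; first by rewrite addn0.
apply: leq_trans IHn; rewrite addnS -addSn leq_add2r.
have /lie_idealP idn := lie_derived_ideal n idU.
have le_n : (lie_derived n.+1 U <= lie_derived n U)%VS.
  by apply/lie_prodvP => x y _; apply: idn.
rewrite ltnNge; apply/negP => ge_n; case: noP; exists n; apply/eqP.
by rewrite eqEdim le_n.
Qed.

(** The center is an abelian, hence solvable, ideal. *)
Lemma lie_semisimple_center x : lie_semisimple L -> (forall y, [lie x, y] = 0) -> x = 0.
Proof.
move=> ssL cx.
have [||Z ZP] := @vspace_of_pred _ _ (fun z : L => forall y, [lie z, y] = 0).
- exact: lie0l.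
- by move=> a u v u0 v0 y; rewrite lieDl lieZl u0 v0 scaler0 addr0.
have idZ : lie_ideal fullv Z.
  by apply/lie_idealP => u v /ZP v0; rewrite lieC v0 oppr0 mem0v.
have : x \in Z by apply/ZP.
rewrite (ssL _ idZ) ?memv0 => [/eqP //|]; exists 1%N; apply/eqP.
rewrite -subv0; apply/lie_prodvP => u v /ZP u0 _.
by rewrite u0 mem0v.
Qed.

End LieIdentities.

(** * Engel's theorem *)

(* Jacobson's proof: a subalgebra acting nilpotently on L, of maximal dimension
   among those contained in P, is P itself, since otherwise it can be enlarged
   by an element normalizing it. *)
Section Engel.
Variables (K : fieldType) (L : lieAlgType K).
Implicit Types (x y z s : L) (U V W P : {vspace L}).

(** The series starts from the whole algebra, on which [U] acts: its [n]-th term vanishes exactly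
    when all products of [n] operators ad u, with u in [U], are zero. *)
Fixpoint lie_lower n U : {vspace L} :=
  if n is n'.+1 then lie_prodv U (lie_lower n' U) else fullv.

Lemma lie_lower_stable U s n : (forall u, u \in U -> [lie s, u] \in U) ->
  forall z, z \in lie_lower n U -> [lie s, z] \in lie_lower n U.
Proof.
move=> sU; elim: n => [|n IHn] z /=; first by rewrite !memvf.
have [||W WP] := @vspace_of_pred _ _
    (fun z => [lie s, z] \in lie_prodv U (lie_lower n U)).
- by rewrite linear0 mem0v.
- by move=> a u v u0 v0; rewrite linearP memvD ?memvZ.
move=> zn; apply/WP; apply: subvP zn; apply/lie_prodvP => u v uU vn.
by apply/WP; rewrite lie_leibniz memvD ?lie_prodv_mem ?sU ?IHn.
Qed.

(** Each term of the series of [U] is stable under [U + <[s]>]. On the quotient of two successive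
    terms [U] acts by zero, so only the nilpotent ad s remains, and [m] further steps pass from one
    term to the next. *)
Lemma lie_lower_line U s m :
    (forall u, u \in U -> [lie s, u] \in U) ->
    (forall u v, u \in U -> v \in U -> [lie u, v] \in U) ->
    (forall z, iter m (lie s) z = 0) -> (exists n, lie_lower n U = 0%VS) ->
  exists n, lie_lower n (U + <[s]>)%VS = 0%VS.
Proof.
move=> sU UU nil_s [n n0]; pose U' := (U + <[s]>)%VS.
suff [N] : exists N, (lie_lower N U' <= lie_lower n U)%VS.
  by rewrite n0 subv0 => /eqP; exists N.
elim: n {n0} => [|n [N le_N]]; first by exists 0%N; apply: subvf.
have stab u' z k : u' \in U' -> z \in lie_lower k U -> [lie u', z] \in lie_lower k U.
  case/memv_addP=> u uU [_ /vlineP[a ->] ->] zk.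
  rewrite lieDl lieZl memvD ?memvZ // lie_lower_stable //.
  by move=> v; apply: UU.
exists (m + N)%N.
suff: forall j z, z \in lie_lower (j + N) U' -> exists2 v, v \in lie_lower n U
    & z - iter j (lie s) v \in lie_lower n.+1 U.
  by move=> le_m; apply/subvP => z /le_m[v _]; rewrite nil_s subr0.
elim=> [|j IHj].
  by move=> z /(subvP le_N) zn; exists z => //=; rewrite subrr mem0v.
have itj v : v \in lie_lower n U -> iter j (lie s) v \in lie_lower n U.
  by move=> vn; elim: (j) => //= i; apply: lie_lower_stable.
have iter_lin i a (u v : L) :
    iter i (lie s) (a *: u + v) = a *: iter i (lie s) u + iter i (lie s) v.
  by elim: i => //= i ->; rewrite linearP.
have iter0 i : iter i (lie s) 0 = 0 by elim: i => //= i ->; rewrite linear0.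
have [||W WP] := @vspace_of_pred _ _ (fun z => exists2 v, v \in lie_lower n U
    & z - iter j.+1 (lie s) v \in lie_lower n.+1 U).
- exists 0; rewrite ?mem0v // sub0r memvN.
  by rewrite iter0 mem0v.
- move=> a u v [u1 u1n uP] [v1 v1n vP]; exists (a *: u1 + v1).
    by rewrite memvD ?memvZ.
  by rewrite iter_lin opprD addrACA -scalerBr memvD ?memvZ.
move=> z zP; apply/WP; apply: subvP zP; rewrite addSn /=.
apply/lie_prodvP => u' w u'U' /IHj[v vn wv]; apply/WP.
case/memv_addP: (u'U') => u uU [_ /vlineP[a ->] u'E].
exists (a *: v); first by rewrite memvZ.
have -> : iter j.+1 (lie s) (a *: v) = a *: [lie s, iter j (lie s) v].
  by rewrite -[a *: v]addr0 iter_lin iter0 addr0.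
rewrite -(subrK (iter j (lie s) v) w) linearD /= -addrA memvD //.
  exact: (stab u' _ n.+1).
by rewrite u'E lieDl lieZl addrK lie_prodv_mem ?itj.
Qed.

Lemma engel P : (forall u v, u \in P -> v \in P -> [lie u, v] \in P) ->
    (forall x, x \in P -> exists m, forall z, iter m (lie x) z = 0) ->
  exists n, lie_lower n P = 0%VS.
Proof.
move=> PP nilP.
(* If [P] itself fails, every good subalgebra can be enlarged, so good dimensions exceed \dim P. *)
pose good d := exists U, [/\ \dim U = d, (U <= P)%VS,
  forall u v, u \in U -> v \in U -> [lie u, v] \in U & exists n, lie_lower n U = 0%VS].
apply: Classical_Prop.NNPP => nilPF.
suff: forall d, exists2 d', (d <= d')%N & good d'.
  case/(_ (\dim P).+1) => d' lt_d' [U [dU sUP _ _]].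
  by have := dimvS sUP; rewrite dU leqNgt lt_d'.
elim=> [|d [d' le_d' [U [dU sUP UU nilU]]]].
  exists 0%N => //; exists 0%VS; rewrite dimv0 sub0v; split=> // [u v|].
    by rewrite !memv0 => /eqP-> _; rewrite lie0l eqxx.
  exists 1%N; apply/eqP; rewrite -subv0; apply/lie_prodvP => u v.
  by rewrite memv0 => /eqP-> _; rewrite lie0l mem0v.
(* The spaces [Q m] end inside [U] because [U] acts nilpotently, while [Q 0 = P] does not lie in
   [U]. At the last [Q m] not contained in [U], any element outside [U] normalizes [U]. *)
pose Q m : {vspace L} := iter m (lie_prodv U) P.
have QP m : (Q m <= P)%VS.
  elim: m => //= m IHm; apply/lie_prodvP => u v /(subvP sUP) uP /(subvP IHm).
  exact: PP.
have [s [sP sU_ sU]] : exists s,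
    [/\ s \in P, s \notin U & forall u, u \in U -> [lie s, u] \in U].
  apply: Classical_Prop.NNPP => no_s; case: nilU => n n0.
  suff: forall m, ~~ (Q m <= U)%VS.
    move/(_ n)/negP; apply; apply: (@subv_trans _ _ (lie_lower n U)).
      by elim: n {n0} => /= [|n IHn]; rewrite ?subvf // lie_prodvS.
    by rewrite n0 sub0v.
  elim=> [|m IHm]; apply/negP => le_U.
    by apply: nilPF; have -> : P = U by [apply/eqP; rewrite eqEsubv le_U]; exists n.
  have [s sQ sU] : exists2 s, s \in Q m & s \notin U.
    apply: Classical_Prop.NNPP => no_s'; case/negP: IHm; apply/subvP => s sQ.
    by apply: contraT => sU; case: no_s'; exists s.
  apply: no_s; exists s; split=> // [|u uU]; first exact: (subvP (QP m)).
  by rewrite lieC memvN; apply: (subvP le_U); apply: lie_prodv_mem.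
have [m nil_s] := nilP s sP.
exists (\dim (U + <[s]>)%VS).
  apply: leq_ltn_trans le_d' _; rewrite -dU ltnNge; apply: contra sU_ => le_dim.
  have /eqP-> : U == (U + <[s]>)%VS by rewrite eqEdim addvSl.
  by rewrite memvE addvSr.
exists (U + <[s]>)%VS; split=> // [|u v|].
- by rewrite subv_add sUP -memvE.
- move=> /memv_addP[u1 u1U [_ /vlineP[a ->] ->]] /memv_addP[v1 v1U [_ /vlineP[b ->] ->]].
  apply: (subvP (addvSl _ _)).
  have Us u2 : u2 \in U -> [lie u2, s] \in U by move=> u2U; rewrite lieC memvN sU.
  rewrite lieDl !linearD /= !linearZ /= !lieZl liexx !scaler0 addr0.
  by rewrite !memvD ?memvZ ?sU ?Us ?UU.
- exact: lie_lower_line nil_s nilU.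
Qed.

End Engel.

(** * The Killing form and Cartan's criterion *)

Section Killing.
Variables (K : fieldType) (L : lieAlgType K).
Implicit Types (x y z : L) (P : {vspace L}).

Local Notation n := (\dim {:L}).
Local Notation toV := (rVof (vbasis {:L})).
Local Notation ofV := (vecof (vbasis {:L})).
Let toVK : cancel toV ofV := rVofK (vbasisP {:L}).
Let ofVK : cancel ofV toV := vecofK (vbasisP {:L}).

Definition ad_mx x : 'M[K]_n := lin1_mx (toV \o lie x \o ofV).

Lemma mul_ad_mx x (v : 'rV_n) : v *m ad_mx x = toV [lie x, ofV v].
Proof. exact: mul_rV_lin1. Qed.

Lemma ad_mx_linear : linear ad_mx.
Proof.
move=> a x y; apply/row_matrixP => i; rewrite linearP /= !rowE !mul_ad_mx.
by rewrite lieDl lieZl linearP.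
Qed.
HB.instance Definition _ := GRing.isLinear.Build K L _ _ ad_mx ad_mx_linear.

(** Matrices act on row vectors from the right, which reverses the order in the commutator. *)
Lemma ad_mx_lie x y : ad_mx [lie x, y] = ad_mx y *m ad_mx x - ad_mx x *m ad_mx y.
Proof.
apply/row_matrixP => i; rewrite linearB /= !rowE !mulmxA !mul_ad_mx !toVK -linearB.
by rewrite /= (lie_leibniz x) addrK.
Qed.

Lemma ad_mx_nilpotent x m : ad_mx x ^+ m = 0 -> forall z, iter m (lie x) z = 0.
Proof.
move=> xm z; apply: (can_inj toVK); rewrite linear0 -[RHS](mulmx0 _ (toV z)) -xm.
elim: m {xm} => [|m IHm] /=; first by rewrite expr0 mulmx1.
by rewrite exprSr mulmxA -IHm mul_ad_mx toVK.
Qed.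

Definition killing x y := \tr (ad_mx x *m ad_mx y).

Lemma killingC x y : killing x y = killing y x.
Proof. exact: mxtrace_mulC. Qed.

Lemma killingPl a u v y : killing (a *: u + v) y = a * killing u y + killing v y.
Proof. by rewrite /killing linearP mulmxDl -scalemxAl mxtraceD mxtraceZ. Qed.

Lemma killing_lie x y z : killing [lie x, y] z = killing x [lie y, z].
Proof.
rewrite /killing !ad_mx_lie mulmxBl mulmxBr !linearB /= !mulmxA.
rewrite [X in X - _ = _]mxtrace_mulC mulmxA; congr (_ - _).
by rewrite [RHS]mxtrace_mulC mulmxA [RHS]mxtrace_mulC mulmxA.
Qed.

Variable K0 : [pchar K] =i pred0.

Lemma cartan_nilpotent P x :
    (forall a b, a \in P -> killing a b = 0) -> x \in lie_prodv P P ->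
  exists m, ad_mx x ^+ m = 0.
Proof.
move=> kP xPP.
have [F [f [zs Dzs]]] := splitting_field_exists (monic_neq0 (char_poly_monic (ad_mx x))).
have F0 : [pchar F] =i pred0 by move=> p; rewrite (fmorph_pchar f) K0.
(* Extension of scalars: [ad] is the adjoint representation, in coordinates, of the algebra over [F]
   with the structure constants of [L]. *)
pose A i := map_mx f (ad_mx (vbasis {:L})`_i).
pose ad (b : 'rV[F]_n) := \sum_i b 0 i *: A i.
have ad_lin : linear ad.
  move=> c u v; rewrite /ad scaler_sumr -big_split; apply: eq_bigr => i _ /=.
  by rewrite !mxE scalerDl scalerA.
pose adl : {linear 'rV[F]_n -> 'M[F]_n} :=
  HB.pack ad (GRing.isLinear.Build F _ _ _ ad ad_lin).
have adE y : ad (map_mx f (toV y)) = map_mx f (ad_mx y).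
  rewrite -[y in RHS]toVK [ad_mx _]linear_sum map_mx_sum; apply: eq_bigr => i _.
  by rewrite linearZ map_mxZ mxE.
have derD y : mx_derivation adl (map_mx f (ad_mx y)).
  move=> b; rewrite [b]row_sum_delta mulmx_suml !(linear_sum adl) mulmx_suml.
  rewrite mulmx_sumr -sumrB; apply: eq_bigr => i _.
  rewrite -scalemxAl ![adl _]linearZ /= -scalemxAl -scalemxAr -scalerBr.
  congr (_ *: _); have -> : delta_mx 0 i = map_mx f (toV (ofV (delta_mx 0 i))).
    by rewrite ofVK map_delta_mx.
  by rewrite -map_mxM mul_ad_mx toVK !adE ad_mx_lie map_mxB !map_mxM.
have trY Y : mx_derivation adl Y -> \tr (map_mx f (ad_mx x) *m Y) = 0.
  move=> derY.
  have [||W WP] := @vspace_of_pred _ _ (fun y => \tr (map_mx f (ad_mx y) *m Y) = 0).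
  - by rewrite linear0 map_mx0 mul0mx mxtrace0.
  - move=> c u v u0 v0; rewrite linearP map_mxD map_mxZ mulmxDl -scalemxAl.
    by rewrite mxtraceD mxtraceZ u0 v0 mulr0 addr0.
  apply/WP; apply: subvP xPP; apply/lie_prodvP => a b aP bP; apply/WP.
  (* By cyclicity the trace of ad [a, b] times Y is, up to sign, that of ad a times a commutator of
     ad b and Y. As Y is a derivation, the commutator is [ad] of the image of b under Y; expanded in
     the basis, it yields values of [killing a], all zero. *)
  rewrite ad_mx_lie map_mxB !map_mxM mulmxBl linearB /= -mulmxA.
  rewrite mxtrace_mulC -!mulmxA -linearB -mulmxBr -opprB mulmxN linearN /=.
  have := derY (map_mx f (toV b)); rewrite /= adE => <-.
  rewrite mulmx_sumr [\tr _]raddf_sum big1 ?oppr0 // => i _.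
  rewrite /= -scalemxAr mxtraceZ -map_mxM trace_map_mx.
  by rewrite [\tr _]kP // rmorph0 mulr0.
rewrite map_char_poly in Dzs; have [m Dm] := replica_nilpotent F0 (derD x) Dzs trY.
exists m; apply: (@map_mx_inj _ _ f); rewrite map_mx0 -[RHS]Dm.
by elim: (m) => [|k IHk]; rewrite ?map_mx1 // !exprS -IHk map_mxM.
Qed.

End Killing.

(** * Lie-orthogonal operators on a semisimple algebra *)

Section Semisimple.
Variables (K : fieldType) (K0 : [pchar K] =i pred0).
Variables (L : lieAlgType K) (ssL : lie_semisimple L).
Implicit Types (x y z : L).

(** The derived series of the radical [R] of the form stabilizes at a perfect ideal [P]. By Cartan
    and Engel [P] acts nilpotently, and P = [P, P] keeps [P] inside every [lie_lower m P], so [P] is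
    zero. Thus [R] is solvable. *)
Lemma killing_nondegenerate x : (forall y, killing x y = 0) -> x = 0.
Proof.
move=> kx.
have [||R RP] := @vspace_of_pred _ _ (fun u : L => forall y, killing u y = 0).
- by move=> y; rewrite /killing linear0 mul0mx mxtrace0.
- by move=> a u v u0 v0 y; rewrite killingPl u0 v0 mulr0 addr0.
have idR : lie_ideal fullv R.
  apply/lie_idealP => u v /RP v0; rewrite lieC memvN; apply/RP => y.
  by rewrite killing_lie v0.
have : x \in R by apply/RP.
rewrite (ssL idR) ?memv0 => [/eqP //|].
have [n] := lie_derived_stable idR; set P := lie_derived n R => PP; exists n.
have /lie_idealP idP : lie_ideal fullv P by apply: lie_derived_ideal.
have PR : (P <= R)%VS.
  rewrite /P; elim: (n) => //= m IHm; apply/lie_prodvP => u v _ /(subvP IHm).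
  by move/lie_idealP: idR; apply.
have [u v _|u uP|m Pm] := @engel _ _ P; first exact: idP.
  suff [m um] : exists m, ad_mx u ^+ m = 0 by exists m; apply: ad_mx_nilpotent.
  apply: (cartan_nilpotent K0 (P := P)).
    by move=> a b /(subvP PR)/RP.
  by rewrite PP.
apply/eqP; rewrite -subv0 -Pm; elim: m {Pm} => [|m IHm]; first exact: subvf.
by rewrite -[X in (X <= _)%VS]PP lie_prodvS.
Qed.

Lemma lie_antiadjoint_eq0 (B : L -> L) :
  (forall x y, [lie B x, y] = - [lie x, B y]) -> forall x, B x = 0.
Proof.
move=> antiB x; apply: lie_semisimple_center => // y.
apply: killing_nondegenerate => z; pose F x y z := killing [lie B x, y] z.
have killN u v : killing (- u) v = - killing u v.
  by rewrite /killing linearN mulNmx linearN.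
have symF u v w : F u v w = F v u w by rewrite /F antiB lieC opprK.
have antiF u v w : F u v w = - F u w v.
  by rewrite /F !killing_lie lieC killingC killN -killingC.
have : F x y z = - F x y z.
  (* The arguments run through xyz, yxz, yzx, zyx, zxy, xzy, xyz, with three sign changes. *)
  by rewrite {1}symF antiF symF antiF opprK symF antiF.
move/eqP; rewrite -addr_eq0 -mulr2n -mulr_natl mulf_eq0.
by have /pcharf0P -> := K0 => /= /eqP.
Qed.

Lemma lie_orthogonal_adjoint (J : 'End(L)) : lie_orthogonal J ->
  (forall x, J (J x) = x) /\ (forall x y, [lie J x, y] = [lie x, J y]).
Proof.
move=> orthJ; have kerJ : lker J == 0%VS.
  rewrite -subv0; apply/subvP => x; rewrite memv_ker memv0 => /eqP Jx0.
  by apply/eqP/lie_semisimple_center => // y; rewrite -orthJ Jx0 lie0l.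
have JV x y : [lie J x, y] = [lie x, (J^-1)%VF y].
  by rewrite -[RHS]orthJ lker0_lfunVK.
have VJ x y : [lie (J^-1)%VF x, y] = [lie x, J y] by rewrite lieC -JV -lieC.
have JJ x : J x = (J^-1)%VF x.
  apply/eqP; rewrite -subr_eq0; apply/eqP.
  apply: (lie_antiadjoint_eq0 (B := fun x => J x - (J^-1)%VF x)) => u v.
  by rewrite lieBl linearB /= JV VJ opprB.
by split=> [x|x y]; rewrite ?JV -?JJ // JJ lker0_lfunK.
Qed.

Lemma lie_orthogonal_ideal (J : 'End(L)) (S : {vspace L}) :
    lie_orthogonal J -> lie_ideal fullv S -> lie_simple S ->
  (forall x, x \in S -> J x = x) \/ (forall x, x \in S -> J x = - x).
Proof.
move=> /lie_orthogonal_adjoint[JJ adjJ] idS [SS simpS].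
have two0 : 2 != 0 :> K by have /pcharf0P -> := K0.
(* For a = 1 or a = -1 this is the projection onto the [a]-eigenspace of [J]. *)
pose p a w := 2^-1 *: (w + a *: J w).
have pE a w : p a w + p (- a) w = w.
  rewrite -scalerDr addrACA -scalerDl subrr scale0r addr0 -mulr2n.
  by rewrite -scaler_nat scalerA mulVf ?scale1r.
have Jp a w : a * a = 1 -> J (p a w) = a *: p a w.
  move=> aa; rewrite linearZ linearD linearZ /= JJ [RHS]scalerA.
  rewrite [a * _]mulrC -[RHS]scalerA.
  by rewrite [a *: (_ + _)]scalerDr scalerA aa scale1r addrC.
have p_adj a x y : [lie p a x, y] = [lie x, p a y].
  by rewrite lieZl lieDl lieZl adjJ /p [RHS]linearZ /= [in RHS]linearD /= [in RHS]linearZ.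
have orth a u v : a * a = 1 -> J u = a *: u -> J v = - a *: v -> [lie u, v] = 0.
  move=> aa Ju Jv; have := adjJ u v; rewrite Ju Jv lieZl linearZ /= scaleNr.
  move/eqP; rewrite -addr_eq0 -mulr2n -scaler_nat !scaler_eq0 (negPf two0) /=.
  case/orP=> [/eqP a0|/eqP //]; move/eqP: aa.
  by rewrite a0 mul0r eq_sym oner_eq0.
have idJ a x v : a * a = 1 -> J v = a *: v -> J [lie x, v] = a *: [lie x, v].
  move=> aa Jv; have aaN : - a * - a = 1 by rewrite mulrNN.
  have Jvn : J v = - - a *: v by rewrite opprK.
  have -> : [lie x, v] = [lie p a x, v].
    by rewrite -{1}(pE a x) lieDl (orth (- a) (p (- a) x)) ?Jp ?addr0.
  set w := [lie _, v]; suff pw : p (- a) w = 0 by rewrite -[w](pE a) pw addr0 Jp.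
  (* The component of [w] for [- a] is central: moving the projection onto [y] and applying the
     Leibniz rule leaves only brackets between opposite eigenspaces. *)
  apply: lie_semisimple_center => // y; rewrite p_adj lieC /w lie_leibniz.
  rewrite (orth (- a) (p (- a) y) v) ?Jp // linear0 addr0.
  by rewrite (orth (- a) (p (- a) y)) ?Jp ?opprK // lie0l oppr0.
pose E a := lker (J - a *: \1)%VF.
have EP a x : x \in E a <-> J x = a *: x.
  rewrite memv_ker add_lfunE opp_lfunE scale_lfunE id_lfunE subr_eq0.
  by split=> /eqP.
have idE a : a * a = 1 -> lie_ideal S (S :&: E a)%VS.
  move=> aa; rewrite /lie_ideal capvSl; apply/lie_prodvP => u v uS.
  rewrite !memv_cap => /andP[vS /EP Jv]; move/lie_idealP: idS => -> //=.
  by apply/EP/idJ.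
have aa1 : 1 * 1 = 1 :> K by rewrite mulr1.
have aaN : -1 * -1 = 1 :> K by rewrite mulrNN mulr1.
have [I1|I1] := simpS _ (idE 1 aa1); last first.
  by left=> x; rewrite -{1}I1 memv_cap => /andP[_ /EP->]; rewrite scale1r.
have [I2|I2] := simpS _ (idE (-1) aaN); last first.
  by right=> x; rewrite -{1}I2 memv_cap => /andP[_ /EP->]; rewrite scaleN1r.
(* If [S] meets both eigenspaces trivially, the brackets of [y] in [S] with the two components of
   [x] lie in these intersections, so [S] is abelian. *)
case/eqP: SS; apply/eqP; rewrite -subv0; apply/lie_prodvP => x y _ yS.
have /lie_idealP idS' := idS.
have cy a v : a * a = 1 -> (S :&: E a = 0)%VS -> J v = a *: v -> [lie v, y] = 0.
  move=> aa Ia Jv; apply/eqP; rewrite -memv0 -Ia memv_cap idS' //=.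
  by rewrite lieC memvN; apply/EP/idJ.
by rewrite -(pE 1 x) lieDl (cy 1) ?(cy (-1)) ?Jp // addr0 mem0v.
Qed.

End Semisimple.

(** * Assembling the signs on the simple components *)

Theorem theorem3 (K : fieldType) (charK0 : [pchar K] =i pred0)
    (L : lieAlgType K) (ssL : lie_semisimple L)
    (k : nat) (Ls : 'I_k -> {vspace L})
    (idealLs : forall i : 'I_k, lie_ideal fullv (Ls i))
    (simpleLs : forall i : 'I_k, lie_simple (Ls i))
    (dxLs : directv (\sum_(i < k) Ls i)%VS)
    (sumLs : (\sum_(i < k) Ls i)%VS = fullv)
    (J : 'End(L)) (orthJ : lie_orthogonal J) :
  exists Js : forall i : 'I_k, 'End(subvs_of (Ls i)),
    J = dsum_lfun Js /\
    (forall i : 'I_k, Js i = \1%VF \/ Js i = - \1%VF).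
Proof.
(* Inclusion of subspaces is a Boolean test, so it can select the sign in the definition of [Js]. *)
pose fixed i := (Ls i <= lker (J - \1)%VF)%VS.
have fixedP i : reflect (forall x, x \in Ls i -> J x = x) (fixed i).
  apply: (iffP subvP) => fixJ x /fixJ; rewrite memv_ker add_lfunE opp_lfunE.
    by rewrite id_lfunE subr_eq0 => /eqP.
  by rewrite id_lfunE => ->; rewrite subrr.
pose Js i : 'End(subvs_of (Ls i)) := if fixed i then \1%VF else - \1%VF.
exists Js; split; last first.
  by move=> i; rewrite /Js; case: ifP; [left | right].
apply/lfunP => x; have : x \in (\sum_(i < k) Ls i)%VS by rewrite sumLs memvf.
case/memv_sumP=> y yLs ->; rewrite !linear_sum; apply: eq_bigr => i _.
have yi : y i \in Ls i by apply: yLs.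
have /= -> := dsum_lfunE Js (Subvs yi) dxLs.
rewrite /Js; case: ifP => [/fixedP fixJ|/fixedP nfixJ].
  by rewrite id_lfunE fixJ.
have [//|negJ] := lie_orthogonal_ideal charK0 ssL orthJ (idealLs i) (simpleLs i).
by rewrite opp_lfunE id_lfunE linearN negJ.
Qed.
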